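(* The Dynamic Calculus for EAK, as defined in the context (with or without the Grishin rules), enjoys cut elimination and the subformula property: every sequent derivable in the Dynamic Calculus has a derivation in the Dynamic Calculus containing no application of any of the four cut rules, and in which every operational term that occurs is a subterm of some operational term occurring in the end sequent.
   Context: **The Dynamic Calculus.** Notation: an inference is written ''premises / conclusion''; ''//'' marks a rule applicable in both directions. Hatted symbols are structural connectives, unhatted ones operational connectives, and symbols with a tilde are structural connectives called virtual adjoints. *Operational terms.* There are four pairwise disjoint types $\mathsf{Fm},\mathsf{Fnc},\mathsf{Act},\mathsf{Ag}$. Given sets of atomic propositions $p$, of atomic functional actions $\alpha$ and of atomic agents $\mathtt a$: the terms of type $\mathsf{Fnc}$ are the atoms $\alpha$; the terms of type $\mathsf{Ag}$ are the atoms $\mathtt a$; the terms of type $\mathsf{Act}$ are $\gamma ::= \mathtt a\blacktriangle_3\alpha\mid \mathtt a\vartriangle_3\alpha$; the terms of type $\mathsf{Fm}$ are $A::= p\mid\bot\mid\top\mid A\wedge A\mid A\vee A\mid A\to A\mid A\leftarrow A\mid A\succ A\mid A\prec A\mid \alpha\,\sharp_0 A\mid\gamma\,\sharp_1 A\mid\mathtt a\,\sharp_2 A$, where $\sharp\in\{\vartriangle,\blacktriangle,\vartriangleright,\blacktriangleright\}$. *Structures.* The types $\mathsf{FM}\ni X$, $\mathsf{FNC}\ni F$, $\mathsf{ACT}\ni\Gamma$, $\mathsf{AG}\ni\mathbf a$ are defined by simultaneous recursion: $X::=A\mid \mathrm I\mid X;X\mid X>X\mid X<X\mid F\,\hat\sharp_0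 X\mid\Gamma\,\hat\sharp_1X\mid\mathbf a\,\hat\sharp_2X$ with $\hat\sharp\in\{\hat\vartriangle,\hat\blacktriangle,\hat\vartriangleright,\hat\blacktriangleright\}$; $F::=\alpha\mid X\tilde\vartriangleleft_0X\mid X\tilde\blacktriangleleft_0X\mid\mathbf a\,\tilde\vartriangleright_3\Gamma\mid\mathbf a\,\tilde\blacktriangleright_3\Gamma$; $\Gamma::=\gamma\mid\mathbf a\,\hat\blacktriangle_3F\mid\mathbf a\,\hat\vartriangle_3F\mid X\hat\vartriangleleft_1X\mid X\hat\blacktriangleleft_1X$; $\mathbf a::=\mathtt a\mid X\tilde\vartriangleleft_2X\mid X\tilde\blacktriangleleft_2X\mid\Gamma\tilde\vartriangleleft_3F\mid\Gamma\tilde\blacktriangleleft_3F$. Sequents have the form $x\vdash y$ with $x,y$ structures. Below $X,Y,Z,W$ are of type $\mathsf{FM}$; $A,B$ of type $\mathsf{Fm}$; $x,y,z$ are structures and $a,b$ operational terms of the type making the expression well formed. *Axioms.* $\mathtt a\vdash\mathtt a$; $\alpha\vdash\alpha$; $\bot\vdash\mathrm I$; $\mathrm I\vdash\top$; and *atom*: $F_1\circ_1(F_2\circ_2\cdots(F_n\circ_n p)\cdots)\vdash G_1\rhd_1(G_2\rhd_2\cdots(G_m\rhd_m p)\cdots)$ for $n,m\ge0$, $F_i,G_j\in\mathsf{FNC}$, $\circ_i\in\{\hat\vartriangle_0,\hat\blacktriangle_0\}$, $\rhd_j\in\{\hat\vartriangleright_0,\hat\blacktriangleright_0\}$ (in particular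 $p\vdash p$). *Cut rules* (one per type): $x\vdash a,\ a\vdash y\ /\ x\vdash y$, with $x,a,y$ all of the same type (agents, functional actions, actions, or formulas). *Propositional structural rules.* $X\vdash Y\ //\ \mathrm I\vdash Y<X$; $X\vdash Y\ //\ X<Y\vdash\mathrm I$; $X\vdash Y\ //\ \mathrm I\vdash X>Y$; $X\vdash Y\ //\ Y>X\vdash\mathrm I$; $\mathrm I\vdash X\ /\ Y\vdash X$; $X\vdash\mathrm I\ /\ X\vdash Y$; $X\vdash Z\ /\ Y\vdash Z<X$; $X\vdash Z\ /\ X<Z\vdash Y$; $X\vdash Z\ /\ Y\vdash X>Z$; $X\vdash Z\ /\ Z>X\vdash Y$; $X;X\vdash Y\ /\ X\vdash Y$; $Y\vdash X;X\ /\ Y\vdash X$; $Y;X\vdash Z\ /\ X;Y\vdash Z$; $Z\vdash X;Y\ /\ Z\vdash Y;X$; $X;(Y;Z)\vdash W\ /\ (X;Y);Z\vdash W$; $W\vdash(Z;Y);X\ /\ W\vdash Z;(Y;X)$. Display postulates: $X;Y\vdash Z\ //\ X\vdash Z<Y$; $Z\vdash X;Y\ //\ Z<Y\vdash X$; $X;Y\vdash Z\ //\ Y\vdash X>Z$; $Z\vdash X;Y\ //\ X>Z\vdash Y$. Grishin rules (added to obtain the classical base): $X>(Y;Z)\vdash W\ //\ (X>Y);Z\vdash W$; $W\vdash X>(Y;Z)\ //\ W\vdash(X>Y);Z$. *Propositional operational rules.* $X\vdash\mathrm I\ /\ X\vdash\bot$; $\mathrm I\vdash X\ /\ \top\vdash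 X$; $A;B\vdash Z\ /\ A\wedge B\vdash Z$; $X\vdash A,\ Y\vdash B\ /\ X;Y\vdash A\wedge B$; $A\vdash X,\ B\vdash Y\ /\ A\vee B\vdash X;Y$; $Z\vdash A;B\ /\ Z\vdash A\vee B$; $B\vdash Y,\ X\vdash A\ /\ B\leftarrow A\vdash Y<X$; $Z\vdash B<A\ /\ Z\vdash B\leftarrow A$; $B<A\vdash Z\ /\ B\prec A\vdash Z$; $Y\vdash B,\ A\vdash X\ /\ Y<X\vdash B\prec A$; $X\vdash A,\ B\vdash Y\ /\ A\to B\vdash X>Y$; $Z\vdash A>B\ /\ Z\vdash A\to B$; $A>B\vdash Z\ /\ A\succ B\vdash Z$; $A\vdash X,\ Y\vdash B\ /\ X>Y\vdash A\succ B$. *Heterogeneous operational rules.* For $0\le i\le3$ and $\sharp\in\{\vartriangle,\blacktriangle\}$: $a\,\hat\sharp_i\,b\vdash z\ /\ a\,\sharp_i\,b\vdash z$; $x\vdash a,\ y\vdash b\ /\ x\,\hat\sharp_i\,y\vdash a\,\sharp_i\,b$. For $0\le i\le2$ and $\sharp\in\{\vartriangleright,\blacktriangleright\}$: $x\vdash a,\ B\vdash Y\ /\ a\,\sharp_iB\vdash x\,\hat\sharp_iY$; $Z\vdash a\,\hat\sharp_iB\ /\ Z\vdash a\,\sharp_iB$. *Heterogeneous display postulates.* For $0\le i\le2$: $x\hat\vartriangle_iy\vdash z\ //\ y\vdash x\hat\blacktriangleright_iz$; $x\hat\blacktriangle_iy\vdash z\ //\ y\vdash x\hat\vartriangleright_iz$.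 For $i=1$: $x\hat\vartriangle_1y\vdash z\ //\ x\vdash z\hat\blacktriangleleft_1y$; $x\hat\blacktriangle_1y\vdash z\ //\ x\vdash z\hat\vartriangleleft_1y$. For $i\in\{0,2,3\}$: $x\hat\vartriangle_iy\vdash z\ //\ x\vdash z\tilde\blacktriangleleft_iy$; $x\hat\blacktriangle_iy\vdash z\ //\ x\vdash z\tilde\vartriangleleft_iy$. For $i=3$: $x\hat\vartriangle_3y\vdash z\ //\ y\vdash x\tilde\blacktriangleright_3z$; $x\hat\blacktriangle_3y\vdash z\ //\ y\vdash x\tilde\vartriangleright_3z$. *Necessitation, conjugation, Fischer Servi, monotonicity*, for $0\le i\le2$: $\mathrm I\vdash W\ /\ x\hat\vartriangle_i\mathrm I\vdash W$; $\mathrm I\vdash W\ /\ x\hat\blacktriangle_i\mathrm I\vdash W$; $W\vdash\mathrm I\ /\ W\vdash x\hat\vartriangleright_i\mathrm I$; $W\vdash\mathrm I\ /\ W\vdash x\hat\blacktriangleright_i\mathrm I$; $x\hat\vartriangle_i((x\hat\blacktriangle_iY);Z)\vdash W\ /\ Y;(x\hat\vartriangle_iZ)\vdash W$; $x\hat\blacktriangle_i((x\hat\vartriangle_iY);Z)\vdash W\ /\ Y;(x\hat\blacktriangle_iZ)\vdash W$; $W\vdash x\hat\vartriangleright_i((x\hat\blacktriangleright_iY);Z)\ /\ W\vdash Y;(x\hat\vartriangleright_iZ)$; $W\vdash x\hat\blacktriangleright_i((x\hat\vartriangleright_iY);Z)\ /\ W\vdash Y;(x\hat\blacktriangleright_iZ)$;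 $(x\hat\vartriangleright_iY)>(x\hat\vartriangle_iZ)\vdash W\ /\ x\hat\vartriangle_i(Y>Z)\vdash W$; $(x\hat\blacktriangleright_iY)>(x\hat\blacktriangle_iZ)\vdash W\ /\ x\hat\blacktriangle_i(Y>Z)\vdash W$; $W\vdash(x\hat\vartriangle_iY)>(x\hat\vartriangleright_iZ)\ /\ W\vdash x\hat\vartriangleright_i(Y>Z)$; $W\vdash(x\hat\blacktriangle_iY)>(x\hat\blacktriangleright_iZ)\ /\ W\vdash x\hat\blacktriangleright_i(Y>Z)$; $(x\hat\vartriangle_iY);(x\hat\vartriangle_iZ)\vdash W\ /\ x\hat\vartriangle_i(Y;Z)\vdash W$; $(x\hat\blacktriangle_iY);(x\hat\blacktriangle_iZ)\vdash W\ /\ x\hat\blacktriangle_i(Y;Z)\vdash W$; $W\vdash(x\hat\vartriangleright_iY);(x\hat\vartriangleright_iZ)\ /\ W\vdash x\hat\vartriangleright_i(Y;Z)$; $W\vdash(x\hat\blacktriangleright_iY);(x\hat\blacktriangleright_iZ)\ /\ W\vdash x\hat\blacktriangleright_i(Y;Z)$. *Interaction rules.* swap-out: $(\mathbf a\hat\blacktriangle_3F)\hat\blacktriangle_1(\mathbf a\hat\blacktriangle_2X)\vdash Y\ /\ \mathbf a\hat\blacktriangle_2(F\hat\blacktriangle_0X)\vdash Y$; $X\vdash(\mathbf a\hat\blacktriangle_3F)\hat\blacktriangleright_1(\mathbf a\hat\blacktriangleright_2Y)\ /\ X\vdash\mathbf a\hat\blacktriangleright_2(F\hat\blacktriangleright_0Y)$.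 swap-in: $\mathbf a\hat\blacktriangle_2(F\hat\blacktriangle_0X)\vdash Y\ /\ (\mathbf a\hat\blacktriangle_3F)\hat\blacktriangle_1(\mathbf a\hat\blacktriangle_2((F\hat\vartriangle_0\mathrm I);X))\vdash Y$; $X\vdash\mathbf a\hat\blacktriangleright_2(F\hat\blacktriangleright_0Y)\ /\ X\vdash(\mathbf a\hat\blacktriangle_3F)\hat\blacktriangleright_1(\mathbf a\hat\blacktriangleright_2((F\hat\vartriangle_0\mathrm I)>Y))$. balance: $X\vdash Y\ /\ F\hat\vartriangle_0X\vdash F\hat\vartriangleright_0Y$, for $F\in\mathsf{FNC}$. *)

(* Defs.v *)
Set Implicit Arguments.
Unset Strict Implicit.
Unset Printing Implicit Defensive.

Record signature : Type := Signature {
  prop_atom : Type;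
  fnc_atom : Type;
  agent_atom : Type
}.

(** The heterogeneous connectives with subscript 0, 1 and 2 take a left argument
    of type Fnc, Act and Ag respectively.  The subscript is therefore identified
    with the type of that argument. *)
Inductive actor : Type := Fnc | Act | Ag.
Inductive sort : Type := Fm | Op (i : actor).
Coercion Op : actor >-> sort.

(** The triangles occur in white/black pairs; a white triangle is adjoint to
    black ones and conversely. *)
Inductive colour : Type := white | black.
Definition flip (c : colour) : colour :=
  match c with white => black | black => white end.

(** Conj, Disj, Imp, Pmi, Excl, Lcxe stand for ∧, ∨, →, ←, ≻, ≺. *)
Inductive connective : Type := Conj | Disj | Imp | Pmi | Excl | Lcxe.

(** [TTri white], [TTri black] are ▵, ▲ and [TArr white], [TArr black] are ▹, ▸
    (subscript [i]); [TTri3] is ▵ or ▲ with subscript 3. *)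
Inductive term (Sg : signature) : sort -> Type :=
| TProp (p : prop_atom Sg) : term Sg Fm
| TBot : term Sg Fm
| TTop : term Sg Fm
| TBin (k : connective) (A B : term Sg Fm) : term Sg Fm
| TTri (i : actor) (c : colour) (a : term Sg i) (A : term Sg Fm) : term Sg Fm
| TArr (i : actor) (c : colour) (a : term Sg i) (A : term Sg Fm) : term Sg Fm
| TFnc (f : fnc_atom Sg) : term Sg Fnc
| TAg (a : agent_atom Sg) : term Sg Ag
| TTri3 (c : colour) (a : term Sg Ag) (f : term Sg Fnc) : term Sg Act.

Arguments TBot {Sg}.
Arguments TTop {Sg}.

(** [SLeft] is ◁ or ◀ with subscript [i]: a virtual adjoint for 0 and 2, a hatted
    connective for 1.  [SArr3] and [SLeft3] are the virtual adjoints with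
    subscript 3. *)
Inductive struct (Sg : signature) : sort -> Type :=
| STerm (s : sort) (t : term Sg s) : struct Sg s
| SI : struct Sg Fm
| SSemi (X Y : struct Sg Fm) : struct Sg Fm
| SGt (X Y : struct Sg Fm) : struct Sg Fm
| SLt (X Y : struct Sg Fm) : struct Sg Fm
| STri (i : actor) (c : colour) (x : struct Sg i) (Y : struct Sg Fm) : struct Sg Fm
| SArr (i : actor) (c : colour) (x : struct Sg i) (Y : struct Sg Fm) : struct Sg Fm
| SLeft (i : actor) (c : colour) (X Y : struct Sg Fm) : struct Sg i
| STri3 (c : colour) (a : struct Sg Ag) (F : struct Sg Fnc) : struct Sg Act
| SArr3 (c : colour) (a : struct Sg Ag) (G : struct Sg Act) : struct Sg Fnc
| SLeft3 (c : colour) (G : struct Sg Act) (F : struct Sg Fnc) : struct Sg Ag.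

Arguments SI {Sg}.
Arguments SLeft {Sg i} c X Y.

Coercion STerm : term >-> struct.

Inductive sequent (Sg : signature) : Type :=
| Sequent (s : sort) (x y : struct Sg s).

Declare Scope dc_scope.
Delimit Scope dc_scope with dc.
Open Scope dc_scope.

Notation "x ⊢ y" := (Sequent x y) (at level 70, no associativity) : dc_scope.
Notation "X ⨾ Y" := (SSemi X Y) (at level 60, no associativity) : dc_scope.
Notation "X ≫ Y" := (SGt X Y) (at level 60, no associativity) : dc_scope.
Notation "X ≪ Y" := (SLt X Y) (at level 60, no associativity) : dc_scope.
Notation "x △[ c ] y" := (STri c x y)
  (at level 60, no associativity, format "x  △[ c ]  y") : dc_scope.
Notation "x ▷[ c ] y" := (SArr c x y)
  (at level 60, no associativity, format "x  ▷[ c ]  y") : dc_scope.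
Notation "x ◁[ c ] y" := (SLeft c x y)
  (at level 60, no associativity, format "x  ◁[ c ]  y") : dc_scope.
Notation "x △₃[ c ] y" := (STri3 c x y)
  (at level 60, no associativity, format "x  △₃[ c ]  y") : dc_scope.
Notation "x ▷₃[ c ] y" := (SArr3 c x y)
  (at level 60, no associativity, format "x  ▷₃[ c ]  y") : dc_scope.
Notation "x ◁₃[ c ] y" := (SLeft3 c x y)
  (at level 60, no associativity, format "x  ◁₃[ c ]  y") : dc_scope.

(** F₁ ∘₁ (F₂ ∘₂ ⋯ (Fₙ ∘ₙ p)⋯) *)
Inductive atom_left (Sg : signature) (p : prop_atom Sg) : struct Sg Fm -> Prop :=
| atom_left_nil : atom_left p (TProp p)
| atom_left_cons (c : colour) (F : struct Sg Fnc) (X : struct Sg Fm) :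
    atom_left p X -> atom_left p (F △[c] X).

(** G₁ ▷₁ (G₂ ▷₂ ⋯ (Gₘ ▷ₘ p)⋯) *)
Inductive atom_right (Sg : signature) (p : prop_atom Sg) : struct Sg Fm -> Prop :=
| atom_right_nil : atom_right p (TProp p)
| atom_right_cons (c : colour) (G : struct Sg Fnc) (Y : struct Sg Fm) :
    atom_right p Y -> atom_right p (G ▷[c] Y).

Inductive axiom (Sg : signature) : sequent Sg -> Prop :=
| ax_agent (a : agent_atom Sg) : axiom (TAg a ⊢ TAg a)
| ax_fnc (f : fnc_atom Sg) : axiom (TFnc f ⊢ TFnc f)
| ax_bot : axiom (TBot ⊢ SI)
| ax_top : axiom (SI ⊢ TTop)
| ax_atom (p : prop_atom Sg) (X Y : struct Sg Fm) :
    atom_left p X -> atom_right p Y -> axiom (X ⊢ Y).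

(** Rules applicable in both directions; the Grishin rules are present when
    [grishin] is [true]. *)
Inductive two_way (Sg : signature) (grishin : bool) :
  sequent Sg -> sequent Sg -> Prop :=
| tw_I_lt_r (X Y : struct Sg Fm) : two_way grishin (X ⊢ Y) (SI ⊢ Y ≪ X)
| tw_I_lt_l (X Y : struct Sg Fm) : two_way grishin (X ⊢ Y) (X ≪ Y ⊢ SI)
| tw_I_gt_r (X Y : struct Sg Fm) : two_way grishin (X ⊢ Y) (SI ⊢ X ≫ Y)
| tw_I_gt_l (X Y : struct Sg Fm) : two_way grishin (X ⊢ Y) (Y ≫ X ⊢ SI)
| tw_semi_lt_l (X Y Z : struct Sg Fm) : two_way grishin (X ⨾ Y ⊢ Z) (X ⊢ Z ≪ Y)
| tw_semi_lt_r (X Y Z : struct Sg Fm) : two_way grishin (Z ⊢ X ⨾ Y) (Z ≪ Y ⊢ X)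
| tw_semi_gt_l (X Y Z : struct Sg Fm) : two_way grishin (X ⨾ Y ⊢ Z) (Y ⊢ X ≫ Z)
| tw_semi_gt_r (X Y Z : struct Sg Fm) : two_way grishin (Z ⊢ X ⨾ Y) (X ≫ Z ⊢ Y)
| tw_grishin_l (X Y Z W : struct Sg Fm) : grishin = true ->
    two_way grishin (X ≫ (Y ⨾ Z) ⊢ W) ((X ≫ Y) ⨾ Z ⊢ W)
| tw_grishin_r (X Y Z W : struct Sg Fm) : grishin = true ->
    two_way grishin (W ⊢ X ≫ (Y ⨾ Z)) (W ⊢ (X ≫ Y) ⨾ Z)
| tw_tri_arr (i : actor) (c : colour) (x : struct Sg i) (y z : struct Sg Fm) :
    two_way grishin (x △[c] y ⊢ z) (y ⊢ x ▷[flip c] z)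
| tw_tri_left (i : actor) (c : colour) (x : struct Sg i) (y z : struct Sg Fm) :
    two_way grishin (x △[c] y ⊢ z) (x ⊢ z ◁[flip c] y)
| tw_tri_arr3 (c : colour) (x : struct Sg Ag) (y : struct Sg Fnc) (z : struct Sg Act) :
    two_way grishin (x △₃[c] y ⊢ z) (y ⊢ x ▷₃[flip c] z)
| tw_tri_left3 (c : colour) (x : struct Sg Ag) (y : struct Sg Fnc) (z : struct Sg Act) :
    two_way grishin (x △₃[c] y ⊢ z) (x ⊢ z ◁₃[flip c] y).

(** [one_way S T]: the one-premise rule S / T. *)
Inductive one_way (Sg : signature) : sequent Sg -> sequent Sg -> Prop :=
| ow_weak_I_l (X Y : struct Sg Fm) : one_way (SI ⊢ X) (Y ⊢ X)
| ow_weak_I_r (X Y : struct Sg Fm) : one_way (X ⊢ SI) (X ⊢ Y)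
| ow_weak_lt_r (X Y Z : struct Sg Fm) : one_way (X ⊢ Z) (Y ⊢ Z ≪ X)
| ow_weak_lt_l (X Y Z : struct Sg Fm) : one_way (X ⊢ Z) (X ≪ Z ⊢ Y)
| ow_weak_gt_r (X Y Z : struct Sg Fm) : one_way (X ⊢ Z) (Y ⊢ X ≫ Z)
| ow_weak_gt_l (X Y Z : struct Sg Fm) : one_way (X ⊢ Z) (Z ≫ X ⊢ Y)
| ow_contr_l (X Y : struct Sg Fm) : one_way (X ⨾ X ⊢ Y) (X ⊢ Y)
| ow_contr_r (X Y : struct Sg Fm) : one_way (Y ⊢ X ⨾ X) (Y ⊢ X)
| ow_exch_l (X Y Z : struct Sg Fm) : one_way (Y ⨾ X ⊢ Z) (X ⨾ Y ⊢ Z)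
| ow_exch_r (X Y Z : struct Sg Fm) : one_way (Z ⊢ X ⨾ Y) (Z ⊢ Y ⨾ X)
| ow_assoc_l (X Y Z W : struct Sg Fm) :
    one_way (X ⨾ (Y ⨾ Z) ⊢ W) ((X ⨾ Y) ⨾ Z ⊢ W)
| ow_assoc_r (X Y Z W : struct Sg Fm) :
    one_way (W ⊢ (Z ⨾ Y) ⨾ X) (W ⊢ Z ⨾ (Y ⨾ X))
| ow_bot_r (X : struct Sg Fm) : one_way (X ⊢ SI) (X ⊢ TBot)
| ow_top_l (X : struct Sg Fm) : one_way (SI ⊢ X) (TTop ⊢ X)
| ow_and_l (A B : term Sg Fm) (Z : struct Sg Fm) :
    one_way (A ⨾ B ⊢ Z) (TBin Conj A B ⊢ Z)
| ow_or_r (A B : term Sg Fm) (Z : struct Sg Fm) :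
    one_way (Z ⊢ A ⨾ B) (Z ⊢ TBin Disj A B)
| ow_pmi_r (A B : term Sg Fm) (Z : struct Sg Fm) :
    one_way (Z ⊢ B ≪ A) (Z ⊢ TBin Pmi B A)
| ow_lcxe_l (A B : term Sg Fm) (Z : struct Sg Fm) :
    one_way (B ≪ A ⊢ Z) (TBin Lcxe B A ⊢ Z)
| ow_imp_r (A B : term Sg Fm) (Z : struct Sg Fm) :
    one_way (Z ⊢ A ≫ B) (Z ⊢ TBin Imp A B)
| ow_excl_l (A B : term Sg Fm) (Z : struct Sg Fm) :
    one_way (A ≫ B ⊢ Z) (TBin Excl A B ⊢ Z)
| ow_tri_l (i : actor) (c : colour) (a : term Sg i) (B : term Sg Fm) (Z : struct Sg Fm) :
    one_way (a △[c] B ⊢ Z) (TTri c a B ⊢ Z)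
| ow_tri3_l (c : colour) (a : term Sg Ag) (b : term Sg Fnc) (z : struct Sg Act) :
    one_way (a △₃[c] b ⊢ z) (TTri3 c a b ⊢ z)
| ow_arr_r (i : actor) (c : colour) (a : term Sg i) (B : term Sg Fm) (Z : struct Sg Fm) :
    one_way (Z ⊢ a ▷[c] B) (Z ⊢ TArr c a B)
| ow_nec_l (i : actor) (c : colour) (x : struct Sg i) (W : struct Sg Fm) :
    one_way (SI ⊢ W) (x △[c] SI ⊢ W)
| ow_nec_r (i : actor) (c : colour) (x : struct Sg i) (W : struct Sg Fm) :
    one_way (W ⊢ SI) (W ⊢ x ▷[c] SI)
| ow_conj_l (i : actor) (c : colour) (x : struct Sg i) (Y Z W : struct Sg Fm) :
    one_way (x △[c] ((x △[flip c] Y) ⨾ Z) ⊢ W) (Y ⨾ (x △[c] Z) ⊢ W)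
| ow_conj_r (i : actor) (c : colour) (x : struct Sg i) (Y Z W : struct Sg Fm) :
    one_way (W ⊢ x ▷[c] ((x ▷[flip c] Y) ⨾ Z)) (W ⊢ Y ⨾ (x ▷[c] Z))
| ow_fs_l (i : actor) (c : colour) (x : struct Sg i) (Y Z W : struct Sg Fm) :
    one_way ((x ▷[c] Y) ≫ (x △[c] Z) ⊢ W) (x △[c] (Y ≫ Z) ⊢ W)
| ow_fs_r (i : actor) (c : colour) (x : struct Sg i) (Y Z W : struct Sg Fm) :
    one_way (W ⊢ (x △[c] Y) ≫ (x ▷[c] Z)) (W ⊢ x ▷[c] (Y ≫ Z))
| ow_mon_l (i : actor) (c : colour) (x : struct Sg i) (Y Z W : struct Sg Fm) :
    one_way ((x △[c] Y) ⨾ (x △[c] Z) ⊢ W) (x △[c] (Y ⨾ Z) ⊢ W)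
| ow_mon_r (i : actor) (c : colour) (x : struct Sg i) (Y Z W : struct Sg Fm) :
    one_way (W ⊢ (x ▷[c] Y) ⨾ (x ▷[c] Z)) (W ⊢ x ▷[c] (Y ⨾ Z))
| ow_swap_out_l (a : struct Sg Ag) (F : struct Sg Fnc) (X Y : struct Sg Fm) :
    one_way ((a △₃[black] F) △[black] (a △[black] X) ⊢ Y)
            (a △[black] (F △[black] X) ⊢ Y)
| ow_swap_out_r (a : struct Sg Ag) (F : struct Sg Fnc) (X Y : struct Sg Fm) :
    one_way (X ⊢ (a △₃[black] F) ▷[black] (a ▷[black] Y))
            (X ⊢ a ▷[black] (F ▷[black] Y))
| ow_swap_in_l (a : struct Sg Ag) (F : struct Sg Fnc) (X Y : struct Sg Fm) :
    one_way (a △[black] (F △[black] X) ⊢ Y)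
            ((a △₃[black] F) △[black] (a △[black] ((F △[white] SI) ⨾ X)) ⊢ Y)
| ow_swap_in_r (a : struct Sg Ag) (F : struct Sg Fnc) (X Y : struct Sg Fm) :
    one_way (X ⊢ a ▷[black] (F ▷[black] Y))
            (X ⊢ (a △₃[black] F) ▷[black] (a ▷[black] ((F △[white] SI) ≫ Y)))
| ow_balance (F : struct Sg Fnc) (X Y : struct Sg Fm) :
    one_way (X ⊢ Y) (F △[white] X ⊢ F ▷[white] Y).

(** [binary S1 S2 T]: the two-premise rule S1, S2 / T, cut excluded. *)
Inductive binary (Sg : signature) :
  sequent Sg -> sequent Sg -> sequent Sg -> Prop :=
| bin_and_r (A B : term Sg Fm) (X Y : struct Sg Fm) :
    binary (X ⊢ A) (Y ⊢ B) (X ⨾ Y ⊢ TBin Conj A B)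
| bin_or_l (A B : term Sg Fm) (X Y : struct Sg Fm) :
    binary (A ⊢ X) (B ⊢ Y) (TBin Disj A B ⊢ X ⨾ Y)
| bin_pmi_l (A B : term Sg Fm) (X Y : struct Sg Fm) :
    binary (B ⊢ Y) (X ⊢ A) (TBin Pmi B A ⊢ Y ≪ X)
| bin_lcxe_r (A B : term Sg Fm) (X Y : struct Sg Fm) :
    binary (Y ⊢ B) (A ⊢ X) (Y ≪ X ⊢ TBin Lcxe B A)
| bin_imp_l (A B : term Sg Fm) (X Y : struct Sg Fm) :
    binary (X ⊢ A) (B ⊢ Y) (TBin Imp A B ⊢ X ≫ Y)
| bin_excl_r (A B : term Sg Fm) (X Y : struct Sg Fm) :
    binary (A ⊢ X) (Y ⊢ B) (X ≫ Y ⊢ TBin Excl A B)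
| bin_tri_r (i : actor) (c : colour) (a : term Sg i) (B : term Sg Fm)
    (x : struct Sg i) (Y : struct Sg Fm) :
    binary (x ⊢ a) (Y ⊢ B) (x △[c] Y ⊢ TTri c a B)
| bin_tri3_r (c : colour) (a : term Sg Ag) (b : term Sg Fnc)
    (x : struct Sg Ag) (y : struct Sg Fnc) :
    binary (x ⊢ a) (y ⊢ b) (x △₃[c] y ⊢ TTri3 c a b)
| bin_arr_l (i : actor) (c : colour) (a : term Sg i) (B : term Sg Fm)
    (x : struct Sg i) (Y : struct Sg Fm) :
    binary (x ⊢ a) (B ⊢ Y) (TArr c a B ⊢ x ▷[c] Y).

Inductive derivation (Sg : signature) (grishin : bool) : sequent Sg -> Type :=
| D_axiom (T : sequent Sg) : axiom T -> derivation grishin T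
| D_one_way (S T : sequent Sg) :
    one_way S T -> derivation grishin S -> derivation grishin T
| D_down (S T : sequent Sg) :
    two_way grishin S T -> derivation grishin S -> derivation grishin T
| D_up (S T : sequent Sg) :
    two_way grishin T S -> derivation grishin S -> derivation grishin T
| D_binary (S1 S2 T : sequent Sg) : binary S1 S2 T ->
    derivation grishin S1 -> derivation grishin S2 -> derivation grishin T
| D_cut (s : sort) (x : struct Sg s) (a : term Sg s) (y : struct Sg s) :
    derivation grishin (x ⊢ a) -> derivation grishin (a ⊢ y) ->
    derivation grishin (x ⊢ y).

Fixpoint cut_free (Sg : signature) (grishin : bool) (T : sequent Sg)
  (d : derivation grishin T) : Prop :=
  match d with
  | D_axiom _ _ => True
  | D_one_way _ d1 | D_down _ d1 | D_up _ d1 => cut_free d1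
  | D_binary _ d1 d2 => cut_free d1 /\ cut_free d2
  | D_cut _ _ => False
  end.

Inductive subterm (Sg : signature) (s : sort) (t : term Sg s) :
  forall s' : sort, term Sg s' -> Prop :=
| sub_refl : subterm t t
| sub_bin_l (k : connective) (A B : term Sg Fm) :
    subterm t A -> subterm t (TBin k A B)
| sub_bin_r (k : connective) (A B : term Sg Fm) :
    subterm t B -> subterm t (TBin k A B)
| sub_tri_l (i : actor) (c : colour) (a : term Sg i) (A : term Sg Fm) :
    subterm t a -> subterm t (TTri c a A)
| sub_tri_r (i : actor) (c : colour) (a : term Sg i) (A : term Sg Fm) :
    subterm t A -> subterm t (TTri c a A)
| sub_arr_l (i : actor) (c : colour) (a : term Sg i) (A : term Sg Fm) :
    subterm t a -> subterm t (TArr c a A)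
| sub_arr_r (i : actor) (c : colour) (a : term Sg i) (A : term Sg Fm) :
    subterm t A -> subterm t (TArr c a A)
| sub_tri3_l (c : colour) (a : term Sg Ag) (f : term Sg Fnc) :
    subterm t a -> subterm t (TTri3 c a f)
| sub_tri3_r (c : colour) (a : term Sg Ag) (f : term Sg Fnc) :
    subterm t f -> subterm t (TTri3 c a f).

Fixpoint occurs_struct (Sg : signature) (s : sort) (t : term Sg s)
  (s' : sort) (x : struct Sg s') : Prop :=
  match x with
  | STerm u => subterm t u
  | SI => False
  | SSemi X Y | SGt X Y | SLt X Y | SLeft _ X Y =>
      occurs_struct t X \/ occurs_struct t Y
  | STri _ x Y | SArr _ x Y => occurs_struct t x \/ occurs_struct t Y
  | STri3 _ a F => occurs_struct t a \/ occurs_struct t F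
  | SArr3 _ a G => occurs_struct t a \/ occurs_struct t G
  | SLeft3 _ G F => occurs_struct t G \/ occurs_struct t F
  end.

Definition occurs_sequent (Sg : signature) (s : sort) (t : term Sg s)
  (T : sequent Sg) : Prop :=
  match T with Sequent x y => occurs_struct t x \/ occurs_struct t y end.

Fixpoint occurs_derivation (Sg : signature) (s : sort) (t : term Sg s)
  (grishin : bool) (T : sequent Sg) (d : derivation grishin T) : Prop :=
  occurs_sequent t T \/
  match d with
  | D_axiom _ _ => False
  | D_one_way _ d1 | D_down _ d1 | D_up _ d1 => occurs_derivation t d1
  | D_binary _ d1 d2 | D_cut d1 d2 =>
      occurs_derivation t d1 \/ occurs_derivation t d2
  end.

(* Main.v *)
Require Import Defs.

(** The proof follows Belnap.  A cut on [a] is first pushed up the derivation of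
    [a ⊢ y], by replacing precedent occurrences of [a] by [x], to the places where
    [a] is introduced on the left; then up the derivation of [x ⊢ a] to the places
    where [a] is introduced on the right.  What remains are cuts between two
    introductions of [a], which the display postulates turn into cuts on immediate
    subterms.  Both upward moves are one and the same substitution lemma. *)

Set Implicit Arguments.
Unset Strict Implicit.

(** * Cut-free provability and introductions of terms *)

Inductive provable (Sg : signature) (g : bool) : sequent Sg -> Prop :=
| provable_axiom T : axiom T -> provable g T
| provable_one_way S T : one_way S T -> provable g S -> provable g T
| provable_down S T : two_way g S T -> provable g S -> provable g T
| provable_up S T : two_way g T S -> provable g S -> provable g T
| provable_binary S1 S2 T :
    binary S1 S2 T -> provable g S1 -> provable g S2 -> provable g T.

(** Covers the sequents [t ⊢ Z] obtained directly by an axiom or rule introducing [t] on the left,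
    keeping the cut-free premises as data. Recursion on [t] turns inversion into computation and
    avoids inverting dependently typed sequents. *)
Definition left_intro (Sg : signature) (g : bool) (s : sort) (t : term Sg s) :
    struct Sg s -> Prop :=
  match t in term _ s return struct Sg s -> Prop with
  | TProp p => atom_right p
  | TBot => fun Z => Z = SI
  | TTop => fun Z => provable g (SI ⊢ Z)
  | TBin Conj A B => fun Z => provable g (A ⨾ B ⊢ Z)
  | TBin Disj A B => fun Z =>
      exists X Y, Z = X ⨾ Y /\ provable g (A ⊢ X) /\ provable g (B ⊢ Y)
  | TBin Imp A B => fun Z =>
      exists X Y, Z = X ≫ Y /\ provable g (X ⊢ A) /\ provable g (B ⊢ Y)
  | TBin Pmi B A => fun Z =>
      exists X Y, Z = Y ≪ X /\ provable g (B ⊢ Y) /\ provable g (X ⊢ A)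
  | TBin Excl A B => fun Z => provable g (A ≫ B ⊢ Z)
  | TBin Lcxe B A => fun Z => provable g (B ≪ A ⊢ Z)
  | TTri c a B => fun Z => provable g (a △[c] B ⊢ Z)
  | TArr c a B => fun Z =>
      exists x Y, Z = x ▷[c] Y /\ provable g (x ⊢ a) /\ provable g (B ⊢ Y)
  | TFnc f => fun Z => Z = TFnc f
  | TAg a => fun Z => Z = TAg a
  | TTri3 c a f => fun Z => provable g (a △₃[c] f ⊢ Z)
  end.

Definition right_intro (Sg : signature) (g : bool) (s : sort) (t : term Sg s) :
    struct Sg s -> Prop :=
  match t in term _ s return struct Sg s -> Prop with
  | TProp p => atom_left p
  | TBot => fun Z => provable g (Z ⊢ SI)
  | TTop => fun Z => Z = SI
  | TBin Conj A B => fun Z =>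
      exists X Y, Z = X ⨾ Y /\ provable g (X ⊢ A) /\ provable g (Y ⊢ B)
  | TBin Disj A B => fun Z => provable g (Z ⊢ A ⨾ B)
  | TBin Imp A B => fun Z => provable g (Z ⊢ A ≫ B)
  | TBin Pmi B A => fun Z => provable g (Z ⊢ B ≪ A)
  | TBin Excl A B => fun Z =>
      exists X Y, Z = X ≫ Y /\ provable g (A ⊢ X) /\ provable g (Y ⊢ B)
  | TBin Lcxe B A => fun Z =>
      exists X Y, Z = Y ≪ X /\ provable g (Y ⊢ B) /\ provable g (A ⊢ X)
  | TTri c a B => fun Z =>
      exists x Y, Z = x △[c] Y /\ provable g (x ⊢ a) /\ provable g (Y ⊢ B)
  | TArr c a B => fun Z => provable g (Z ⊢ a ▷[c] B)
  | TFnc f => fun Z => Z = TFnc f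
  | TAg a => fun Z => Z = TAg a
  | TTri3 c a f => fun Z =>
      exists x y, Z = x △₃[c] y /\ provable g (x ⊢ a) /\ provable g (y ⊢ f)
  end.

Lemma left_intro_provable (Sg : signature) (g : bool) (s : sort) (t : term Sg s) Z :
  left_intro g t Z -> provable g (t ⊢ Z).
Proof.
  destruct t as [p| | |[] A B|i c a A|i c a A|f|a|c a f]; simpl; intros H;
    try (apply provable_axiom; subst; now econstructor; eauto; constructor);
    try (refine (provable_one_way _ H); now constructor);
    destruct H as (X & Y & -> & H1 & H2);
    refine (provable_binary _ H1 H2); constructor.
Qed.

Lemma right_intro_provable (Sg : signature) (g : bool) (s : sort) (t : term Sg s) Z :
  right_intro g t Z -> provable g (Z ⊢ t).
Proof.
  destruct t as [p| | |[] A B|i c a A|i c a A|f|a|c a f]; simpl; intros H.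
  all: try (apply provable_axiom; subst; now econstructor; eauto; constructor).
  all: try (refine (provable_one_way _ H); now constructor).
  all: destruct H as (X & Y & -> & H1 & H2);
    refine (provable_binary _ H1 H2); constructor.
Qed.

(** * Substitution along cut-free derivations *)

Definition replacement (Sg : signature) : Type :=
  forall s : sort, term Sg s -> struct Sg s -> Prop.

Definition rigid (s : sort) : bool :=
  match s with Op Fnc | Op Ag => true | _ => false end.
Arguments rigid : simpl nomatch.

(** [replaces L R x x']: [x'] arises from [x] by replacing operational terms [t] by
    some [v], with [L t v] if the occurrence has the same position (precedent or
    succedent) as [x], and with [R t v] otherwise.  Swap-in duplicates its
    parameters of type AG and FNC, and two copies of an occurrence need not be
    replaced alike; hence the arguments of these types are left untouched.  This
    loses nothing: what they contain cannot be displayed, unless they are terms,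
    and cuts on those terms are trivial ([provable_rigid]). *)
Fixpoint replaces (Sg : signature) (L R : replacement Sg) (s : sort)
    (x : struct Sg s) : struct Sg s -> Prop :=
  match x in struct _ s return struct Sg s -> Prop with
  | STerm t => L _ t
  | SI => fun z => z = SI
  | SSemi X Y => fun z => exists X' Y',
      z = X' ⨾ Y' /\ replaces L R X X' /\ replaces L R Y Y'
  | SGt X Y => fun z => exists X' Y',
      z = X' ≫ Y' /\ replaces R L X X' /\ replaces L R Y Y'
  | SLt X Y => fun z => exists X' Y',
      z = X' ≪ Y' /\ replaces L R X X' /\ replaces R L Y Y'
  | @STri _ i c x Y => fun z => exists x' Y',
      z = x' △[c] Y' /\
      (if rigid i then x' = x else replaces L R x x') /\ replaces L R Y Y'
  | @SArr _ i c x Y => fun z => exists x' Y',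
      z = x' ▷[c] Y' /\
      (if rigid i then x' = x else replaces R L x x') /\ replaces L R Y Y'
  | SLeft c X Y => fun z => exists X' Y',
      z = X' ◁[c] Y' /\ replaces L R X X' /\ replaces R L Y Y'
  | STri3 c a F => fun z => z = a △₃[c] F
  | SArr3 c a G => fun z => exists G', z = a ▷₃[c] G' /\ replaces L R G G'
  | SLeft3 c G F => fun z => exists G', z = G' ◁₃[c] F /\ replaces L R G G'
  end.

Definition replaces_sequent (Sg : signature) (L R : replacement Sg)
    (T T' : sequent Sg) : Prop :=
  match T with
  | @Sequent _ s x y => exists x' y',
      T' = (x' ⊢ y') /\
      (if rigid s then x' = x else replaces L R x x') /\ replaces R L y y'
  end.

Lemma replaces_refl (Sg : signature) (L R : replacement Sg) (s : sort)
    (x : struct Sg s) :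
  (forall s (t : term Sg s), L s t t) -> (forall s (t : term Sg s), R s t t) ->
  replaces L R x x.
Proof.
  revert L R; induction x; simpl; intros L R HL HR;
    try destruct (rigid i); eauto 8.
Qed.

Lemma atom_left_replaces_id (Sg : signature) (L R : replacement Sg) p X X' :
  (forall s (t : term Sg s) v, L s t v -> v = t) ->
  atom_left p X -> replaces L R X X' -> atom_left p X'.
Proof.
  intros HL H; revert X'; induction H; simpl; intros X' HX.
  - rewrite (HL _ _ _ HX); constructor.
  - destruct HX as (F' & Y' & -> & _ & HX); constructor; auto.
Qed.

Lemma atom_right_replaces_id (Sg : signature) (L R : replacement Sg) p Y Y' :
  (forall s (t : term Sg s) v, R s t v -> v = t) ->
  atom_right p Y -> replaces R L Y Y' -> atom_right p Y'.
Proof.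
  intros HR H; revert Y'; induction H; simpl; intros Y' HY.
  - rewrite (HR _ _ _ HY); constructor.
  - destruct HY as (F' & Z' & -> & _ & HY); constructor; auto.
Qed.

(* An atom axiom may have its atom undisplayed; displaying it yields another atom
   axiom. *)
Lemma atom_left_replaces (Sg : signature) (g : bool) (L R : replacement Sg) p X X' Y :
  (forall s (t : term Sg s) v Z, L s t v -> left_intro g t Z -> provable g (v ⊢ Z)) ->
  atom_left p X -> replaces L R X X' -> atom_right p Y -> provable g (X' ⊢ Y).
Proof.
  intros HL H; revert X' Y; induction H; simpl; intros X' Y HX HY.
  - exact (HL _ _ _ _ HX HY).
  - destruct HX as (F' & Z' & -> & _ & HX).
    eapply provable_up; [apply tw_tri_arr|].
    apply IHatom_left; [assumption | now constructor].
Qed.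

Lemma flip_flip c : flip (flip c) = c.
Proof. now destruct c. Qed.

(** Serves when the arrow carries the variable colour: [flip (flip c)] does not reduce until [c] is
    a constructor. *)
Lemma tw_arr_tri (Sg : signature) (g : bool) i c (x : struct Sg (Op i)) y z :
  two_way g (x △[flip c] y ⊢ z) (y ⊢ x ▷[c] z).
Proof. pose proof (tw_tri_arr g (flip c) x y z) as H; rewrite flip_flip in H; exact H. Qed.

Lemma atom_right_replaces (Sg : signature) (g : bool) (L R : replacement Sg) p X Y Y' :
  (forall s (t : term Sg s) w W, R s t w -> right_intro g t W -> provable g (W ⊢ w)) ->
  atom_right p Y -> replaces R L Y Y' -> atom_left p X -> provable g (X ⊢ Y').
Proof.
  intros HR H; revert X Y'; induction H; simpl; intros X Y' HY HX.
  - exact (HR _ _ _ _ HY HX).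
  - destruct HY as (F' & Z' & -> & _ & HY).
    eapply provable_down; [apply tw_arr_tri|].
    apply IHatom_right; [assumption | now constructor].
Qed.

Ltac invert_replaces :=
  repeat match goal with
  | H : exists _, _ |- _ => destruct H
  | H : _ /\ _ |- _ => destruct H
  end; subst.

Lemma rigid_refl (Sg : signature) (s : sort) (x : struct Sg s) (P : Prop) :
  P -> if rigid s then x = x else P.
Proof. now destruct (rigid s). Qed.

Ltac solve_replaces :=
  simpl; repeat first
    [ eassumption | reflexivity | solve [auto] | apply rigid_refl | eexists | split ].

(** Structural rules are schematic in their structures and keep occurrences in position, so they
    survive replacement. Only axioms and introductions single out a term; there the hypotheses on
    [left_intro] and [right_intro] do the cut. Reflexivity of [L] and [R] leaves side formulas
    alone, and the final alternative lets at most one atom of an atom axiom change. *)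
Lemma provable_replaces (Sg : signature) (g : bool) (L R : replacement Sg) T T' :
  (forall s (t : term Sg s), L s t t) ->
  (forall s (t : term Sg s), R s t t) ->
  (forall s (t : term Sg s) v Z, L s t v -> left_intro g t Z -> provable g (v ⊢ Z)) ->
  (forall s (t : term Sg s) w W, R s t w -> right_intro g t W -> provable g (W ⊢ w)) ->
  ((forall s (t : term Sg s) v, L s t v -> v = t) \/
   (forall s (t : term Sg s) w, R s t w -> w = t)) ->
  provable g T -> replaces_sequent L R T T' -> provable g T'.
Proof.
  intros L0 R0 HL HR Hid H; revert T'.
  induction H as [T H|S T H _ IH|S T H _ IH|S T H _ IH|S1 S2 T H _ IH1 _ IH2];
    intros T' HT.
  - destruct H; simpl in HT; invert_replaces.
    1, 2, 4: eapply HR; [eassumption | reflexivity].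
    + eapply HL; [eassumption | reflexivity].
    + destruct Hid as [Hid|Hid].
      * eapply atom_right_replaces; eauto using atom_left_replaces_id.
      * eapply atom_left_replaces; eauto using atom_right_replaces_id.
  - destruct H; simpl in HT; invert_replaces.
    (* One-premise introductions: the premise with its parameters replaced is the datum required by
       [HL] or [HR]. All other rules are reapplied. *)
    all: try (eapply HL; [eassumption|]; simpl; apply IH; solve_replaces; fail).
    all: try (eapply HR; [eassumption|]; simpl; apply IH; solve_replaces; fail).
    all: eapply provable_one_way; [|apply IH; solve_replaces]; constructor.
  - destruct H; simpl in HT; invert_replaces;
    (eapply provable_down; [|apply IH; solve_replaces]; now constructor).
  - destruct H; simpl in HT; invert_replaces;
    (eapply provable_up; [|apply IH; solve_replaces]; now constructor).
  - destruct H; simpl in HT; invert_replaces;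
      first [ eapply HL; [eassumption|] | eapply HR; [eassumption|] ];
      do 2 eexists; (split; [reflexivity|]);
      (split; [apply IH1 | apply IH2]); solve_replaces.
Qed.

(** Axioms aside, a rule concluding a sequent of type AG or FNC is a display postulate, and it puts
    a virtual adjoint on the right. A term there can only come from an identity axiom. *)
Lemma provable_rigid (Sg : signature) (g : bool) T :
  provable g T ->
  match T with
  | @Sequent _ s x y => rigid s = true ->
      match y in struct _ s return struct Sg s -> Prop with
      | STerm t => fun x => x = t
      | _ => fun _ => True
      end x
  end.
Proof.
  intros [T' H|S T' H _|S T' H _|S T' H _|S1 S2 T' H _ _]; destruct H; simpl;
    solve [trivial | discriminate | now destruct i].
Qed.

(** * Reduction to principal cuts, and their elimination *)

Definition cut_admissible (Sg : signature) (g : bool) (s : sort) (t : term Sg s) :=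
  forall x y : struct Sg s, provable g (x ⊢ t) -> provable g (t ⊢ y) -> provable g (x ⊢ y).

Definition principal_cut_admissible (Sg : signature) (g : bool) (s : sort)
    (t : term Sg s) :=
  forall x y : struct Sg s, right_intro g t x -> left_intro g t y -> provable g (x ⊢ y).

(** The second upward move: succedent occurrences of [t] in the derivation of [x ⊢ t] become [y],
    and each right introduction met on the way yields a principal cut. *)
Lemma left_principal_cut (Sg : signature) (g : bool) (s : sort) (t : term Sg s) x y :
  principal_cut_admissible g t ->
  provable g (x ⊢ t) -> left_intro g t y -> provable g (x ⊢ y).
Proof.
  intros Ht Hx Hy.
  (* The relations range over all terms [u] and carry the needed facts about [u], so that [u] is
     never compared with [t] across sorts. The disjunct [w = u] keeps occurrences unrelated to the
     cut. *)
  apply (@provable_replaces Sg g (fun _ u v => v = u)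
    (fun _ u w => w = u \/ principal_cut_admissible g u /\ left_intro g u w) (x ⊢ t)).
  - reflexivity.
  - now left.
  - intros s' u v Z -> ; apply left_intro_provable.
  - intros s' u w W [->|[Hu Hw]] HW; [now apply right_intro_provable | now apply Hu].
  - now left.
  - exact Hx.
  - simpl; do 2 eexists; split; [reflexivity|]; split; [|now right].
    apply rigid_refl, replaces_refl; [reflexivity | now left].
Qed.

(** The first upward move: precedent occurrences of [t] in the derivation of [t ⊢ y] become [x], and
    left introductions are settled by [left_principal_cut]. For types AG and FNC the cut is
    trivial. *)
Lemma cut_admissible_of_principal (Sg : signature) (g : bool) (s : sort) (t : term Sg s) :
  principal_cut_admissible g t -> cut_admissible g t.
Proof.
  intros Ht x y Hx Hy; destruct (rigid s) eqn:Es.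
  - now rewrite (provable_rigid Hx Es).
  - apply (@provable_replaces Sg g
      (fun _ u v => v = u \/ principal_cut_admissible g u /\ provable g (v ⊢ u))
      (fun _ u w => w = u) (t ⊢ y)).
    + now left.
    + reflexivity.
    + intros s' u v Z [->|[Hu Hv]] HZ;
        [now apply left_intro_provable | now apply (left_principal_cut Hu)].
    + intros s' u w W -> ; apply right_intro_provable.
    + now right.
    + exact Hy.
    + simpl; rewrite Es; do 2 eexists; split; [reflexivity|]; split; [now right|].
      apply replaces_refl; [reflexivity | now left].
Qed.

Lemma provable_cut (Sg : signature) (g : bool) (s : sort) (t : term Sg s) :
  cut_admissible g t.
Proof.
  induction t as [p| | |[] A IHA B IHB|i c a IHa A IHA|i c a IHa A IHA|f|a|c a IHa f IHf];
    apply cut_admissible_of_principal; intros x y; simpl.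
  (* Two atom axioms meeting at [p] join into one, since the axiom allows prefixes on both sides. *)
  - intros Hx Hy; apply provable_axiom, (ax_atom Hx Hy).
  - now intros Hx ->.
  - now intros -> Hy.
  - intros (X & Y & -> & HX & HY) H.
    (* The pattern of all compound cases: display the place of one immediate subterm, cut there by
       induction, undo the display, and repeat for the other. *)
    eapply provable_up; [apply tw_semi_gt_l|]; apply (IHB _ _ HY).
    eapply provable_down; [apply tw_semi_gt_l|].
    eapply provable_up; [apply tw_semi_lt_l|]; apply (IHA _ _ HX).
    eapply provable_down; [apply tw_semi_lt_l|]; exact H.
  - intros H (X & Y & -> & HX & HY).
    eapply provable_up; [apply tw_semi_gt_r|]; refine (IHB _ _ _ HY).
    eapply provable_down; [apply tw_semi_gt_r|].
    eapply provable_up; [apply tw_semi_lt_r|]; refine (IHA _ _ _ HX).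
    eapply provable_down; [apply tw_semi_lt_r|]; exact H.
  - intros H (X & Y & -> & HX & HY).
    eapply provable_down; [apply tw_semi_gt_l|].
    eapply provable_up; [apply tw_semi_lt_l|]; apply (IHA _ _ HX).
    eapply provable_down; [apply tw_semi_lt_l|]; refine (IHB _ _ _ HY).
    eapply provable_up; [apply tw_semi_gt_l|]; exact H.
  - intros H (X & Y & -> & HX & HY).
    eapply provable_down; [apply tw_semi_lt_l|].
    eapply provable_up; [apply tw_semi_gt_l|]; apply (IHB _ _ HY).
    eapply provable_down; [apply tw_semi_gt_l|]; refine (IHA _ _ _ HX).
    eapply provable_up; [apply tw_semi_lt_l|]; exact H.
  - intros (X & Y & -> & HX & HY) H.
    eapply provable_down; [apply tw_semi_gt_r|].
    eapply provable_up; [apply tw_semi_lt_r|]; refine (IHA _ _ _ HX).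
    eapply provable_down; [apply tw_semi_lt_r|]; apply (IHB _ _ HY).
    eapply provable_up; [apply tw_semi_gt_r|]; exact H.
  - intros (X & Y & -> & HX & HY) H.
    eapply provable_down; [apply tw_semi_lt_r|].
    eapply provable_up; [apply tw_semi_gt_r|]; refine (IHB _ _ _ HY).
    eapply provable_down; [apply tw_semi_gt_r|]; apply (IHA _ _ HX).
    eapply provable_up; [apply tw_semi_lt_r|]; exact H.
  - intros (X & Y & -> & HX & HY) H.
    (* Displaying the left argument is what the adjoint [◁] is for; it is virtual for subscripts 0
       and 2. *)
    eapply provable_up; [apply tw_tri_left|]; apply (IHa _ _ HX).
    eapply provable_down; [apply tw_tri_left|].
    eapply provable_up; [apply tw_tri_arr|]; apply (IHA _ _ HY).
    eapply provable_down; [apply tw_tri_arr|]; exact H.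
  - intros H (X & Y & -> & HX & HY).
    eapply provable_down; [apply tw_arr_tri|].
    eapply provable_up; [apply tw_tri_left|]; apply (IHa _ _ HX).
    eapply provable_down; [apply tw_tri_left|]; refine (IHA _ _ _ HY).
    eapply provable_up; [apply tw_arr_tri|]; exact H.
  - intros -> ->; apply provable_axiom, ax_fnc.
  - intros -> ->; apply provable_axiom, ax_agent.
  - intros (X & Y & -> & HX & HY) H.
    eapply provable_up; [apply tw_tri_left3|]; apply (IHa _ _ HX).
    eapply provable_down; [apply tw_tri_left3|].
    eapply provable_up; [apply tw_tri_arr3|]; apply (IHf _ _ HY).
    eapply provable_down; [apply tw_tri_arr3|]; exact H.
Qed.

Lemma provable_of_derivation (Sg : signature) (g : bool) (T : sequent Sg) :
  derivation g T -> provable g T.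
Proof.
  induction 1.
  1-5: econstructor; eassumption.
  eapply provable_cut; eassumption.
Qed.

(** * The subformula property *)

Lemma one_way_occurs (Sg : signature) S T s (t : term Sg s) :
  one_way S T -> occurs_sequent t S -> occurs_sequent t T.
Proof.
  destruct 1; simpl; intuition auto using subterm.
Qed.

Lemma two_way_occurs (Sg : signature) g S T s (t : term Sg s) :
  two_way g S T -> occurs_sequent t S <-> occurs_sequent t T.
Proof.
  destruct 1; simpl; tauto.
Qed.

Lemma binary_occurs (Sg : signature) S1 S2 T s (t : term Sg s) :
  binary S1 S2 T -> occurs_sequent t S1 \/ occurs_sequent t S2 -> occurs_sequent t T.
Proof.
  destruct 1; simpl; intuition auto using subterm.
Qed.

(** Every rule except cut keeps the terms of its premises as subterms in its conclusion, so
    occurrences travel down to the end sequent. *)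
Lemma cut_free_occurs (Sg : signature) g T (d : derivation g T) s (t : term Sg s) :
  cut_free d -> occurs_derivation t d -> occurs_sequent t T.
Proof.
  induction d as [T H|S T H d IH|S T H d IH|S T H d IH|S1 S2 T H d1 IH1 d2 IH2|];
    simpl; intros Hd [Ht|Ht]; try tauto.
  - exact (one_way_occurs H (IH Hd Ht)).
  - apply (two_way_occurs t H); auto.
  - apply (two_way_occurs t H); auto.
  - apply (binary_occurs H); tauto.
Qed.

Lemma provable_cut_free (Sg : signature) g (T : sequent Sg) :
  provable g T -> exists d : derivation g T, cut_free d.
Proof.
  induction 1 as [T H|S T H _ [d Hd]|S T H _ [d Hd]|S T H _ [d Hd]
                 |S1 S2 T H _ [d1 H1] _ [d2 H2]].
  - now exists (D_axiom g H).
  - now exists (D_one_way H d).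
  - now exists (D_down H d).
  - now exists (D_up H d).
  - now exists (D_binary H d1 d2).
Qed.

Theorem mainTheorem2 (Sg : signature) (grishin : bool) (T : sequent Sg) :
  inhabited (derivation grishin T) ->
  exists d : derivation grishin T,
    cut_free d /\
    (forall (s : sort) (t : term Sg s), occurs_derivation t d ->
       exists (s' : sort) (u : term Sg s'),
         occurs_sequent u T /\ subterm t u).
Proof.
  intros [d0].
  destruct (provable_cut_free (provable_of_derivation d0)) as [d Hd].
  exists d; split; [assumption|]; intros s t Ht.
  (* [occurs_sequent] already counts subterms, so [t] is its own witness. *)
  exists s, t; split; [exact (cut_free_occurs Hd Ht) | constructor].
Qed.
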